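(* Let $n\ge 2$, let $P=(p_1,\dots,p_n)$, $Q=(q_1,\dots,q_n)\in\Gamma_n$, and let $r,R$ be real numbers with $0<r\le \frac{p_i}{q_i}\le R<\infty$ for all $i\in\{1,\dots,n\}$. Then for every real $s\le 0$, $$\frac{r^{2-s}}{(r+1)^2}\,\Phi_s(P\|Q)\ \le\ F(Q\|P)\ \le\ \frac{R^{2-s}}{(R+1)^2}\,\Phi_s(P\|Q),$$ and for every real $s\ge 2$, $$\frac{R^{2-s}}{(R+1)^2}\,\Phi_s(P\|Q)\ \le\ F(Q\|P)\ \le\ \frac{r^{2-s}}{(r+1)^2}\,\Phi_s(P\|Q).$$
   Context: For $n\ge2$, $\Gamma_n=\{P=(p_1,\dots,p_n): p_i>0,\ \sum_{i=1}^n p_i=1\}$. For $P,Q\in\Gamma_n$ and $s\in\mathbb{R}$, the relative information of type $s$ is $\Phi_s(P\|Q)=[s(s-1)]^{-1}\left[\sum_{i=1}^n p_i^s q_i^{1-s}-1\right]$ for $s\ne 0,1$; $\Phi_0(P\|Q)=\sum_{i=1}^n q_i\ln\frac{q_i}{p_i}$; $\Phi_1(P\|Q)=\sum_{i=1}^n p_i\ln\frac{p_i}{q_i}$. The adjoint of the relative JS-divergence is $F(Q\|P)=\sum_{i=1}^n q_i\ln\left(\frac{2q_i}{p_i+q_i}\right)$. *)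

(* Defs.v *)
From mathcomp Require Import all_boot all_order all_algebra.
From mathcomp Require Import all_classical all_reals all_analysis.

Set Implicit Arguments.
Unset Strict Implicit.
Unset Printing Implicit Defensive.

Import Order.TTheory GRing.Theory Num.Theory.

Local Open Scope ring_scope.

Definition Gamma (K : realType) (n : nat) (P : 'I_n -> K) : Prop :=
  (forall i, 0 < P i) /\ \sum_(i < n) P i = 1.

Definition Phi (K : realType) (n : nat) (s : K) (P Q : 'I_n -> K) : K :=
  if s == 0 then \sum_(i < n) Q i * ln (Q i / P i)
  else if s == 1 then \sum_(i < n) P i * ln (P i / Q i)
  else (s * (s - 1))^-1 * (\sum_(i < n) P i `^ s * Q i `^ (1 - s) - 1).

(* F(Q || P), the adjoint of the relative Jensen-Shannon divergence; the
   arguments are written in that order, so the weights Q come first. *)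
Definition adjoint_relJS (K : realType) (n : nat) (Q P : 'I_n -> K) : K :=
  \sum_(i < n) Q i * ln (2 * Q i / (P i + Q i)).

(* Main.v *)
Require Import Defs.
From mathcomp Require Import all_boot all_order all_algebra.
From mathcomp Require Import all_classical all_reals all_analysis.
From mathcomp Require Import ring lra.

(** Both divergences are Csiszar sums [\sum_i q_i f(p_i / q_i)]: for F(Q||P) the
    generator is [f x = ln (2 / (1 + x))], with [f'' x = (x + 1)^-2], and for
    Phi_s it is a function [phi] with [phi'' x = x^(s - 2)].  Both generators
    vanish at 1.

    If [f'' <= g''] on an interval containing 1 and all the ratios [p_i / q_i],
    then [g - f] lies above its tangent at 1; since [\sum_i q_i (p_i / q_i - 1)]
    is zero, the tangent contributes nothing to the sum, and the Csiszar sums of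
    f and g compare as f'' and g'' do ([csiszar_le]).  So the constants m, M in
    [m * Phi_s <= F <= M * Phi_s] may be any bounds on [r, R] of the quotient
    [f'' / phi'' = x^(2 - s) / (x + 1)^2].  This quotient increases in x when
    [s <= 0] and decreases when [2 <= s], so its extreme values are those at the
    end points r and R, which are the constants of the theorem. *)

Set Implicit Arguments.
Unset Strict Implicit.
Unset Printing Implicit Defensive.

Import Order.TTheory GRing.Theory Num.Theory.

Local Open Scope ring_scope.

(** * Comparison of Csiszar sums through second derivatives *)

(** The mean value theorem for points in either order.  The sign condition, that
    [c] is on the same side of [x] as [y], is what [above_tangent] takes from
    the position of [c]. *)
Lemma mean_value_between (K : realType) (f df : K -> K) (a b x y : K) :
  (forall z, a <= z <= b -> is_derive z 1 f (df z)) ->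
  a <= x <= b -> a <= y <= b ->
  exists c, [/\ a <= c <= b, 0 <= (c - x) * (y - x)
              & f y - f x = df c * (y - x)].
Proof.
have ordered (u v : K) : (forall z, a <= z <= b -> is_derive z 1 f (df z)) ->
    a <= u -> u <= v -> v <= b ->
    exists c, [/\ u <= c, c <= v & f v - f u = df c * (v - u)].
  move=> fdf au uv vb.
  have fdf' z : u <= z <= v -> is_derive z 1 f (df z).
    by move=> /andP[uz zv]; apply: fdf; rewrite (le_trans au uz) (le_trans zv vb).
  have [z||c] := @MVT_segment K f df u v uv.
  - by rewrite in_itv/= => /andP[/ltW uz /ltW zv]; apply: fdf'; rewrite uz.
  - apply: derivable_within_continuous => z; rewrite in_itv/=.
    by move=> /fdf'[].
  - by rewrite in_itv/= => /andP[uc cv] E; exists c.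
move=> fdf /andP[ax xb] /andP[ay yb]; have [xy|/ltW yx] := leP x y.
  have [c [xc cy E]] := ordered _ _ fdf ax xy yb; exists c; split=> //.
    by rewrite (le_trans ax xc) (le_trans cy yb).
  by rewrite mulr_ge0 ?subr_ge0.
have [c [yc cx E]] := ordered _ _ fdf ay yx xb; exists c; split=> //.
- by rewrite (le_trans ay yc) (le_trans cx xb).
- by rewrite mulr_le0 ?subr_le0.
- by rewrite -opprB E -mulrN opprB.
Qed.

(** Two mean values give [f y - f x = df c * (y - x)] and
    [df c - df x = ddf d * (c - x)], so that [f y] exceeds the tangent by
    [ddf d * ((c - x) * (y - x))]. *)
Lemma above_tangent (K : realType) (f df ddf : K -> K) (a b x y : K) :
  (forall z, a <= z <= b -> is_derive z 1 f (df z)) ->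
  (forall z, a <= z <= b -> is_derive z 1 df (ddf z)) ->
  (forall z, a <= z <= b -> 0 <= ddf z) ->
  a <= x <= b -> a <= y <= b ->
  f x + df x * (y - x) <= f y.
Proof.
move=> fdf dfddf ddf0 xab yab.
have [c [cab cxy Ec]] := mean_value_between fdf xab yab.
have [d [dab _ Ed]] := mean_value_between dfddf xab cab.
have := mulr_ge0 (ddf0 _ dab) cxy; rewrite mulrA -Ed mulrBl -Ec; lra.
Qed.

Definition csiszar (K : realType) (n : nat) (f : K -> K) (P Q : 'I_n -> K) : K :=
  \sum_(i < n) Q i * f (P i / Q i).

Lemma csiszar_affine (K : realType) (n : nat) (P Q : 'I_n -> K) (m : K) :
  Gamma P -> Gamma Q -> csiszar (fun x => m * (x - 1)) P Q = 0.
Proof.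
move=> [_ P1] [Q0 Q1].
rewrite /csiszar (eq_bigr (fun i => m * P i - m * Q i)) => [|i _].
  by rewrite sumrB -!mulr_sumr P1 Q1 subrr.
by have := Q0 i => Qi0; field; rewrite gt_eqF.
Qed.

(** Otherwise [p_i < q_i] for all [i], or [q_i < p_i] for all [i],
    although both families sum to 1. *)
Lemma ratio_bounds_1 (K : realType) (n : nat) (P Q : 'I_n -> K) (r R : K) :
  Gamma P -> Gamma Q -> (forall i, r <= P i / Q i <= R) -> r <= 1 <= R.
Proof.
move=> [_ P1] [Q0 Q1] rR.
rewrite -[1]P1 -[in r](mulr1 r) -[in R](mulr1 R) -Q1 !mulr_sumr.
by apply/andP; split; apply: ler_sum => i _; have /andP[] := rR i;
  rewrite ler_pdivlMr // ler_pdivrMr.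
Qed.

(** The difference [g - f] lies above its tangent at 1, whose Csiszar sum is
    zero by [csiszar_affine]. *)
Lemma csiszar_le (K : realType) (n : nat) (P Q : 'I_n -> K) (r R : K)
    (f df ddf g dg ddg : K -> K) :
  Gamma P -> Gamma Q -> (forall i, r <= P i / Q i <= R) ->
  (forall x, r <= x <= R -> is_derive x 1 f (df x)) ->
  (forall x, r <= x <= R -> is_derive x 1 df (ddf x)) ->
  (forall x, r <= x <= R -> is_derive x 1 g (dg x)) ->
  (forall x, r <= x <= R -> is_derive x 1 dg (ddg x)) ->
  (forall x, r <= x <= R -> ddf x <= ddg x) ->
  f 1 = g 1 -> csiszar f P Q <= csiszar g P Q.
Proof.
move=> GP GQ rR f1 f2 g1 g2 fg fg1; have [Q0 _] := GQ.
rewrite -subr_ge0 -(csiszar_affine (dg 1 - df 1) GP GQ) /csiszar -sumrB.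
apply: ler_sum => i _; rewrite -mulrBr ler_pM2l //.
have := @above_tangent K (g - f) (dg - df) (ddg - ddf) r R 1 (P i / Q i).
rewrite !fctE fg1 subrr add0r; apply.
- by move=> x xrR; apply: is_deriveB; [exact: g1 | exact: f1].
- by move=> x xrR; apply: is_deriveB; [exact: g2 | exact: f2].
- by move=> x xrR; rewrite subr_ge0 fg.
- exact: ratio_bounds_1 rR.
- exact: rR.
Qed.

(** * The generators of the two divergences *)

(** For [s <> 1], an antiderivative of order two of [x^(s - 2)] that vanishes
    at 1.  With this normalization its first derivative has the same formula
    [x^(s - 1) / (s - 1)] in both branches. *)
Definition phi (K : realType) (s x : K) : K :=
  if s == 0 then - ln x else (s * (s - 1))^-1 * (x `^ s - 1).

Lemma Phi_csiszar (K : realType) (n : nat) (s : K) (P Q : 'I_n -> K) :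
  Gamma P -> Gamma Q -> s != 1 -> Phi s P Q = csiszar (phi s) P Q.
Proof.
move=> [P0 _] [Q0 Q1] s1; rewrite /Phi /csiszar /phi (negPf s1).
have [s0|s0] := eqVneq s 0; first apply: eq_bigr => i _.
  by rewrite -[P i / Q i]invf_div lnV ?opprK // posrE divr_gt0.
(* the constant 1 subtracted in Phi is spread over the sum as [\sum_i q_i] *)
rewrite -[X in _ * (_ - X)]Q1 -sumrB mulr_sumr; apply: eq_bigr => i _.
rewrite mulrCA; congr (_ * _); rewrite mulrBr mulr1; congr (_ - _).
have Qi := Q0 i.
rewrite powRM ?invr_ge0 ?(ltW (P0 i)) ?(ltW Qi) //.
rewrite powRB ?(gt_eqF Qi) ?implybT // powRr1 ?(ltW Qi) //.
by rewrite -(powR_inv1 (ltW Qi)) powRAC powR_inv1 ?powR_ge0 // mulrCA.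
Qed.

Lemma phi_derive (K : realType) (s x : K) : s != 1 -> 0 < x ->
  is_derive x 1 (phi s) ((s - 1)^-1 * x `^ (s - 1)).
Proof.
move=> s1 x0; rewrite /phi; have [->|s0] := eqVneq s 0.
  apply: (is_derive_eq (is_deriveN (is_derive1_ln x0))).
  by rewrite sub0r powR_inv1 ?ltW // invrN1 mulN1r.
have D := is_derive1_powR s x0.
have Dc := is_derive_cst (1 : K) x 1.
apply: (is_derive_eq (is_deriveZ (s * (s - 1))^-1 (is_deriveB D Dc))).
rewrite subr0 /GRing.scale/=.
by field; rewrite subr_eq0 s1.
Qed.

Lemma phi_derive2 (K : realType) (s x : K) : s != 1 -> 0 < x ->
  is_derive x 1 (fun y => (s - 1)^-1 * y `^ (s - 1)) (x `^ (s - 2)).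
Proof.
move=> s1 x0; have D := is_derive1_powR (s - 1) x0.
apply: (is_derive_eq (is_deriveZ (s - 1)^-1 D)).
rewrite /GRing.scale/= mulrA mulVf ?subr_eq0 // mul1r.
by congr (_ `^ _); ring.
Qed.

Lemma phi1 (K : realType) (s : K) : phi s 1 = 0.
Proof. by rewrite /phi; case: ifP; rewrite ?ln1 ?oppr0 // powR1 subrr mulr0. Qed.

Definition relJS_gen (K : realType) (x : K) : K := ln 2 - ln (x + 1).

Lemma adjoint_relJS_csiszar (K : realType) (n : nat) (P Q : 'I_n -> K) :
  Gamma P -> Gamma Q -> adjoint_relJS Q P = csiszar (@relJS_gen K) P Q.
Proof.
move=> [P0 _] [Q0 _]; apply: eq_bigr => i _; congr (_ * _).
have Pi := P0 i; have Qi := Q0 i.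
rewrite /relJS_gen -ln_div ?posrE ?addr_gt0 ?divr_gt0 //; congr (ln _).
by field; rewrite !gt_eqF ?addr_gt0.
Qed.

Lemma relJS_gen_derive (K : realType) (x : K) : 0 < x ->
  is_derive x 1 (@relJS_gen K) (- (x + 1)^-1).
Proof.
move=> x0; have x10 : 0 < x + 1 by rewrite addr_gt0.
have Dshift : is_derive x 1 (fun y => y + 1) (1 + 0).
  exact: is_deriveD (is_derive_id x 1) (is_derive_cst (1 : K) x 1).
have Dln := @is_derive1_comp _ _ _ x _ _ (is_derive1_ln x10) Dshift.
apply: (is_derive_eq (is_deriveB (is_derive_cst (ln 2) x 1) Dln)).
by rewrite addr0 mulr1 sub0r.
Qed.

Lemma relJS_gen_derive2 (K : realType) (x : K) : 0 < x ->
  is_derive x 1 (fun y => - (y + 1)^-1) ((x + 1) ^- 2).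
Proof.
move=> x0; have x10 : x + 1 != 0 by rewrite gt_eqF // addr_gt0.
have Dshift : is_derive x 1 (fun y => y + 1) (1 + 0).
  exact: is_deriveD (is_derive_id x 1) (is_derive_cst (1 : K) x 1).
have [dshift shiftE] := Dshift.
have DV := DeriveDef (derivableV (f := fun y : K => y + 1) x10 dshift)
  (deriveV (f := fun y : K => y + 1) x10 dshift).
apply: (is_derive_eq (is_deriveN DV)).
by rewrite shiftE addr0 scaleNr /GRing.scale/= mulr1 opprK.
Qed.

Lemma relJS_gen1 (K : realType) : relJS_gen (1 : K) = 0.
Proof. exact: subrr. Qed.

(** * The quotient of the second derivatives *)

Definition ratio (K : realType) (s x : K) : K := x `^ (2 - s) / (x + 1) ^+ 2.

Lemma ratio_powR (K : realType) (s x : K) : 0 < x ->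
  ratio s x * x `^ (s - 2) = (x + 1) ^- 2.
Proof.
move=> x0; rewrite /ratio mulrAC -powRD ?(gt_eqF x0) ?implybT //.
by rewrite -[s - 2]opprB subrr powRr0 mul1r.
Qed.

Lemma ratio_homo (K : realType) (s x y : K) :
  s <= 0 -> 0 < x -> x <= y -> ratio s x <= ratio s y.
Proof.
move=> s0 x0 xy; have y0 := lt_le_trans x0 xy.
(* a product of two factors that both increase with z *)
have E (z : K) : 0 < z -> ratio s z = z `^ (- s) * (z / (z + 1)) ^+ 2.
  move=> z0; rewrite /ratio powRD ?(gt_eqF z0) ?implybT //.
  by rewrite powR_mulrn ?ltW // expr_div_n mulrCA mulrA.
rewrite !E //; apply: ler_pM; rewrite ?powR_ge0 ?sqr_ge0 //.
  by apply: ge0_ler_powR; rewrite ?nnegrE ?oppr_ge0 ?(ltW x0) ?(ltW y0).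
rewrite lerXn2r ?nnegrE ?divr_ge0 ?addr_ge0 ?(ltW x0) ?(ltW y0) //.
rewrite ler_pdivrMr ?addr_gt0 // mulrAC ler_pdivlMr ?addr_gt0 //; lra.
Qed.

Lemma ratio_antihomo (K : realType) (s x y : K) :
  2 <= s -> 0 < x -> x <= y -> ratio s y <= ratio s x.
Proof.
move=> s2 x0 xy; have y0 := lt_le_trans x0 xy.
rewrite /ratio -[2 - s]opprB !powRN.
apply: ler_pM; rewrite ?invr_ge0 ?powR_ge0 ?sqr_ge0 //.
  rewrite lef_pV2 ?posrE ?powR_gt0 //.
  by apply: ge0_ler_powR; rewrite ?nnegrE ?subr_ge0 ?(ltW x0) ?(ltW y0).
rewrite lef_pV2 ?posrE ?exprn_gt0 ?addr_gt0 //.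
by rewrite lerXn2r ?nnegrE ?addr_ge0 ?(ltW x0) ?(ltW y0) // lerD2r.
Qed.

(** By [ratio_powR], a bound [m] on [ratio] bounds the second derivative of
    [relJS_gen] by [m] times that of [phi s]. *)
Lemma relJS_Phi_bounds (K : realType) (n : nat) (P Q : 'I_n -> K)
    (r R s m M : K) :
  Gamma P -> Gamma Q -> 0 < r -> (forall i, r <= P i / Q i <= R) -> s != 1 ->
  (forall x, r <= x <= R -> m <= ratio s x <= M) ->
  m * Phi s P Q <= adjoint_relJS Q P <= M * Phi s P Q.
Proof.
move=> GP GQ r0 rR s1 mM.
have pos x : r <= x <= R -> 0 < x by move=> /andP[/(lt_le_trans r0)].
have scale (c : K) :
    c * csiszar (phi s) P Q = csiszar (fun x => c * phi s x) P Q.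
  by rewrite /csiszar mulr_sumr; apply: eq_bigr => i _; rewrite mulrCA.
have Dphi (c x : K) : r <= x <= R -> is_derive x 1 _ _ :=
  fun xrR => is_deriveZ c (phi_derive s1 (pos x xrR)).
have Dphi2 (c x : K) : r <= x <= R -> is_derive x 1 _ _ :=
  fun xrR => is_deriveZ c (phi_derive2 s1 (pos x xrR)).
have DF x (xrR : r <= x <= R) := relJS_gen_derive (pos x xrR).
have DF2 x (xrR : r <= x <= R) := relJS_gen_derive2 (pos x xrR).
have F1 (c : K) : c * phi s 1 = relJS_gen (1 : K).
  by rewrite phi1 relJS_gen1 mulr0.
rewrite Phi_csiszar // adjoint_relJS_csiszar // !scale.
apply/andP; split.
- apply: (csiszar_le GP GQ rR (Dphi m) (Dphi2 m) DF DF2)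
    => [x xrR|]; last exact: F1.
  rewrite /GRing.scale/= -(ratio_powR s) ?pos // ler_wpM2r ?powR_ge0 //.
  by have /andP[] := mM x xrR.
- apply: (csiszar_le GP GQ rR DF DF2 (Dphi M) (Dphi2 M))
    => [x xrR|]; last by rewrite -(F1 M).
  rewrite /GRing.scale/= -(ratio_powR s) ?pos // ler_wpM2r ?powR_ge0 //.
  by have /andP[] := mM x xrR.
Qed.

Theorem theorem4p4 (K : realType) (n : nat) (P Q : 'I_n -> K) (r R : K)
  (hn : (2 <= n)%N) (hP : Gamma P) (hQ : Gamma Q)
  (hr : 0 < r) (hrR : forall i : 'I_n, r <= P i / Q i <= R) :
  (forall s : K, s <= 0 ->
     r `^ (2 - s) / (r + 1) ^+ 2 * Phi s P Q <= adjoint_relJS Q P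
       <= R `^ (2 - s) / (R + 1) ^+ 2 * Phi s P Q) /\
  (forall s : K, 2 <= s ->
     R `^ (2 - s) / (R + 1) ^+ 2 * Phi s P Q <= adjoint_relJS Q P
       <= r `^ (2 - s) / (r + 1) ^+ 2 * Phi s P Q).
Proof.
split=> s hs.
- apply: (relJS_Phi_bounds hP hQ hr hrR).
    by rewrite lt_eqF // (le_lt_trans hs).
  move=> x /andP[rx xR]; have x0 := lt_le_trans hr rx.
  by apply/andP; split; apply: ratio_homo.
- apply: (relJS_Phi_bounds hP hQ hr hrR).
    by rewrite gt_eqF // (lt_le_trans _ hs) // ltr1n.
  move=> x /andP[rx xR]; have x0 := lt_le_trans hr rx.
  by apply/andP; split; apply: ratio_antihomo.
Qed.
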